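(* Let $P$ be the transition matrix of an irreducible Markov chain on the finite state space $\{1,\dots,n\}$, and let $\pi$ be its unique stationary distribution. Run the hunger game process for this chain from an arbitrary initial hunger vector $\mathbf{h}^{(0)}\in\mathbb{R}^n$, and let $\mathbf{v}^{(N)}$ be the firing vector after $N$ steps. Then the sequence of normalized firing vectors $\left\{\frac{1}{N}\mathbf{v}^{(N)}\right\}$ converges to $\pi$, and there exists a constant $C$ such that for all $N\ge 1$, $$\left\|\tfrac{1}{N}\mathbf{v}^{(N)}-\pi\right\|_{1}\le \frac{C}{N}.$$
   Context: Let $P=(P_{ij})$ be the transition matrix of a Markov chain with states $1,\dots,n$ (transition probabilities are real, not necessarily rational), and let $H=P-I$ with $i$-th row $H_i$. The hunger game process (with no insertion or removal of chips) is the following deterministic dynamics on hunger vectors $\mathbf{h}\in\mathbb{R}^n$: at each step, let $i$ be the smallest index for which $\mathbf{h}_i=\max_j \mathbf{h}_j$, and replace $\mathbf{h}$ by $\mathbf{h}+H_i$; one says that the chip fires to state $i$ at this step. The firing vector $\mathbf{v}^{(N)}$ after $N$ steps is the vector whose $i$-th component is the number of those $N$ steps at which $H_i$ was added (i.e. the chip fired to $i$). *)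

(* Defs.v *)
From mathcomp Require Export all_boot all_order all_algebra.
From mathcomp Require Export all_classical all_reals all_analysis.
Import Order.TTheory GRing.Theory Num.Theory.
Import numFieldNormedType.Exports.

Set Implicit Arguments.
Unset Strict Implicit.
Unset Printing Implicit Defensive.

Local Open Scope ring_scope.

(* The chain has n.+1 states, so the state space is never empty; distributions
   and hunger vectors are row vectors, and distributions act on the left. *)
Section MarkovChain.
Variables (R : realType) (n : nat).
Implicit Types (P : 'M[R]_n.+1) (x h : 'rV[R]_n.+1).

Definition is_distribution x : Prop :=
  (forall i, 0 <= x 0 i) /\ \sum_i x 0 i = 1.

Definition transition_matrix P : Prop := forall i, is_distribution (row i P).

Definition irreducible_chain P : Prop :=
  forall i j, exists k : nat, 0 < (P ^+ k) i j.

Definition stationary_distribution P x : Prop :=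
  is_distribution x /\ x *m P = x.

Definition l1norm x : R := \sum_i `|x 0 i|.

Definition is_hungriest h : pred 'I_n.+1 :=
  [pred i | [forall j, h 0 j <= h 0 i]].

(* The inner arg max only supplies some maximizer, as needed by arg min. *)
Definition fired_state h : 'I_n.+1 :=
  [arg min_(i < [arg max_(k > ord0) h 0%R k]%O | is_hungriest h i) i]%N.

Lemma fired_stateP h :
  (forall j, h 0 j <= h 0 (fired_state h)) /\
  (forall i, (forall j, h 0 j <= h 0 i) -> (fired_state h <= i)%N).
Proof.
rewrite /fired_state; case: arg_minnP => [|i /forallP hi i_min].
  by apply/forallP => j; case: arg_maxP => // k _; apply.
by split=> // j hj; apply: i_min; apply/forallP.
Qed.

Definition hunger_step P h : 'rV[R]_n.+1 := h + row (fired_state h) (P - 1%:M).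

Definition hunger_vector P h (N : nat) : 'rV[R]_n.+1 := iter N (hunger_step P) h.

Definition firing_vector P h (N : nat) : 'rV[R]_n.+1 :=
  \row_i #|[pred k : 'I_N | fired_state (hunger_vector P h k) == i]|%:R.

End MarkovChain.

(* Main.v *)
(** The total hunger is constant, because the rows of [P - 1] sum to zero. By
   induction on time, the hunger of a set [S] of states is at most a constant
   minus [#|S|]: firing a state of [S] does not increase it, and firing [i]
   outside [S] increases it by at most one, while before this step either all
   hungers are at most [h_i < 0], or the hunger of [S] is at most that of
   [i |: S], whose bound is better by one. So all hunger vectors are bounded.
   Now [h^(N) - h^(0) = v^(N) (P - 1) = (v^(N) - N pi) (P - 1)], and by
   irreducibility [P - 1] is injective on vectors of sum zero. *)
Require Import Defs.
From mathcomp Require Import lra.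
Import Order.TTheory GRing.Theory Num.Theory.
Import numFieldNormedType.Exports.
Local Open Scope classical_set_scope.
Local Open Scope ring_scope.

Lemma mx_norm_le_l1norm (R : realType) (n : nat) (x : 'rV[R]_n.+1) :
  `|x| <= l1norm x.
Proof.
rewrite [leLHS]mx_normrE; apply: bigmax_le => [|[i j] _] /=.
  exact: sumr_ge0.
by rewrite ord1 /l1norm (bigD1 j) //= lerDl sumr_ge0.
Qed.

(** * Fixed vectors of a stochastic matrix *)

Section StochasticMatrix.
Context {R : realType} {n : nat} {P : 'M[R]_n.+1}.
Hypothesis P_trans : transition_matrix P.
Implicit Types x : 'rV[R]_n.+1.

Lemma transition_ge0 i j : 0 <= P i j.
Proof. by have [+ _] := P_trans i => /(_ j); rewrite mxE. Qed.

Lemma transition_sum i : \sum_j P i j = 1.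
Proof. by have [_ <-] := P_trans i; apply: eq_bigr => j _; rewrite mxE. Qed.

Lemma sum_mul_transition x : \sum_j (x *m P) 0 j = \sum_i x 0 i.
Proof.
under eq_bigr do rewrite mxE.
rewrite exchange_big /=; apply: eq_bigr => i _.
by rewrite -mulr_sumr transition_sum mulr1.
Qed.

(** By the triangle inequality, [|x| <= |x| P] entrywise; both sides have the same total, so they
    agree in every entry. *)
Lemma abs_fixed x : x *m P = x -> map_mx Num.norm x *m P = map_mx Num.norm x.
Proof.
move=> xP.
have le_abs j : `|x 0 j| <= (map_mx Num.norm x *m P) 0 j.
  rewrite -{1}xP !mxE (le_trans (ler_norm_sum _ _ _)) // ler_sum // => i _.
  by rewrite mxE normrM (ger0_norm (transition_ge0 _ _)).
have : \sum_j ((map_mx Num.norm x *m P) 0 j - `|x 0 j|) = 0.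
  by rewrite sumrB sum_mul_transition -sumrB big1 // => j _; rewrite mxE subrr.
move/psumr_eq0P => eq0; apply/rowP => j; rewrite [RHS]mxE.
by apply/eqP; rewrite -subr_eq0 eq0 // => i _; rewrite subr_ge0.
Qed.

(** The all-ones column is in the right kernel of [P - 1], so the determinant vanishes and the left
    kernel is nonzero as well. *)
Lemma fixed_neq0_ex : exists2 x : 'rV[R]_n.+1, x != 0 & x *m P = x.
Proof.
have /det0P[x x0 xP0] : \det (P - 1%:M) == 0.
  rewrite -det_tr; apply/det0P; exists (const_mx 1).
    by apply/eqP => /rowP/(_ 0); rewrite !mxE; apply/eqP; rewrite oner_eq0.
  apply/rowP => i; rewrite !mxE.
  under eq_bigr do rewrite !mxE mul1r.
  rewrite sumrB transition_sum (bigD1 i) //= eqxx big1 ?addr0 ?subrr // => j.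
  by rewrite eq_sym => /negPf ->.
by exists x => //; apply/eqP; rewrite -subr_eq0 -{2}(mulmx1 x) -mulmxBr xP0.
Qed.

Lemma stationary_distribution_ex :
  exists x : 'rV[R]_n.+1, stationary_distribution P x.
Proof.
have [x x0 xP] := fixed_neq0_ex.
pose s := \sum_i `|x 0 i|.
have s0 : s != 0.
  apply: contra_neq x0 => /psumr_eq0P x0.
  by apply/rowP => i; rewrite mxE; apply/normr0_eq0/x0.
exists (s^-1 *: map_mx Num.norm x); split; last by rewrite -scalemxAl abs_fixed.
split=> [i|]; first by rewrite !mxE mulr_ge0 ?invr_ge0 ?sumr_ge0.
under eq_bigr do rewrite !mxE.
by rewrite -mulr_sumr mulVf.
Qed.

Hypothesis P_irr : irreducible_chain P.

(** For every [k], [x_i = 0] is the sum over [j] of the nonnegative terms [x_j (P^k)_ji], so all of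
    them vanish; for each [j], irreducibility gives a [k] with [(P^k)_ji > 0]. *)
Lemma fixed_ge0_eq0 x i :
  (forall j, 0 <= x 0 j) -> x *m P = x -> x 0 i = 0 -> x = 0.
Proof.
move=> x_ge0 xP xi0; apply/rowP => j; rewrite mxE.
have [k Pk] := P_irr j i.
have xPk m : x *m P ^+ m = x.
  by elim: m => [|m IHm]; rewrite ?expr0 ?mulmx1 // exprS mulmxA xP.
have Pm_ge0 m l : 0 <= (P ^+ m) l i.
  elim: m l => [|m IHm] l; first by rewrite expr0 mxE ler0n.
  by rewrite exprS mxE sumr_ge0 // => u _; rewrite mulr_ge0 ?transition_ge0.
move: xi0; rewrite -{1}(xPk k) mxE => /psumr_eq0P xPk0.
have /eqP : x 0 j * (P ^+ k) j i = 0.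
  by apply: xPk0 => // l _; rewrite mulr_ge0.
by rewrite mulf_eq0 (gt_eqF Pk) orbF => /eqP.
Qed.

(** Some entry of [x] is nonpositive. There the nonnegative fixed vector [|x| + x] vanishes, hence
    it vanishes everywhere. So [x <= 0], and the zero sum forces [x = 0]. *)
Lemma fixed_sum0_eq0 x : x *m P = x -> \sum_i x 0 i = 0 -> x = 0.
Proof.
move=> xP x_sum0.
have [i xi_le0] : exists i, x 0 i <= 0.
  apply/existsP; apply: contra_eqT x_sum0 => /existsPn x_gt0.
  rewrite gt_eqF // (bigD1 ord0) //= ltr_pwDl ?sumr_ge0 // => [|j _].
    by rewrite ltNge x_gt0.
  by rewrite ltW // ltNge x_gt0.
have y0 : map_mx Num.norm x + x = 0.
  apply: (@fixed_ge0_eq0 _ i).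
  - by move=> j; rewrite !mxE -lerBlDr sub0r -normrN ler_norm.
  - by rewrite mulmxDl abs_fixed ?xP.
  - by rewrite !mxE ler0_norm // addNr.
have x_le0 j : 0 <= - x 0 j.
  have /rowP/(_ j) := y0; rewrite !mxE => /eqP; rewrite addr_eq0 => /eqP <-.
  exact: normr_ge0.
have /psumr_eq0P x0 : \sum_i (- x 0 i) = 0 by rewrite sumrN x_sum0 oppr0.
by apply/rowP => j; rewrite mxE -[LHS]opprK x0 ?oppr0.
Qed.

Lemma stationary_distribution_unique x y :
  stationary_distribution P x -> stationary_distribution P y -> x = y.
Proof.
move=> [[_ x1] xP] [[_ y1] yP]; apply/eqP; rewrite -subr_eq0; apply/eqP.
apply: fixed_sum0_eq0; first by rewrite mulmxBl xP yP.
under eq_bigr do rewrite !mxE.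
by rewrite sumrB x1 y1 subrr.
Qed.

Lemma sum0_mul_inj_bound : exists2 K : R, 0 <= K &
  forall x, \sum_i x 0 i = 0 -> l1norm x <= l1norm (x *m (P - 1%:M)) * K.
Proof.
(* Adding the all-ones matrix makes [P - 1] invertible without changing its
   action on vectors of sum zero. *)
pose M : 'M[R]_n.+1 := P - 1%:M + const_mx 1.
have mulM x : x *m M = x *m (P - 1%:M) + const_mx (\sum_i x 0 i).
  rewrite mulmxDr; congr (_ + _); apply/rowP => j; rewrite !mxE.
  by apply: eq_bigr => i _; rewrite mxE mulr1.
have M_unit : M \in unitmx.
  rewrite -row_free_unit -kermx_eq0; apply/rowV0P => x /sub_kermxP.
  rewrite mulM => xM0.
  (* The entries of [x (P - 1)] sum to zero, so those of [x M] sum to [n.+1] times the sum of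
     [x]. *)
  have x_sum0 : \sum_i x 0 i = 0.
    have : \sum_j (x *m (P - 1%:M) + const_mx (\sum_i x 0 i)) 0 j = 0.
      by rewrite xM0 big1 // => j _; rewrite mxE.
    under eq_bigr do rewrite mulmxBr mulmx1 2!mxE [X in _ + X + _]mxE.
    under eq_bigr do rewrite [const_mx _ _ _]mxE.
    rewrite big_split /= sumrB sum_mul_transition subrr add0r.
    rewrite sumr_const card_ord => /eqP; rewrite mulrn_eq0 /=.
    by move/eqP.
  apply: fixed_sum0_eq0 => //; apply/eqP; rewrite -subr_eq0.
  rewrite -{2}(mulmx1 x) -mulmxBr -xM0 x_sum0.
  by apply/eqP/rowP => j; rewrite !mxE addr0.
(* The absolute entries of the inverse of [M] add up to a crude bound on its operator norm for
   [l1norm]. *)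
exists (\sum_i \sum_j `|invmx M i j|) => [|x x_sum0].
  by rewrite sumr_ge0 // => i _; rewrite sumr_ge0.
set w := x *m (P - 1%:M).
have -> : x = w *m invmx M.
  rewrite -[LHS](mulmxK M_unit) mulM x_sum0; congr (_ *m _).
  by apply/rowP => j; rewrite !mxE addr0.
have -> : l1norm w * (\sum_i \sum_j `|invmx M i j|)
    = \sum_j \sum_i l1norm w * `|invmx M i j|.
  rewrite exchange_big /= mulr_sumr; apply: eq_bigr => i _.
  by rewrite mulr_sumr.
rewrite {1}/l1norm ler_sum // => j _; rewrite mxE.
rewrite (le_trans (ler_norm_sum _ _ _)) // ler_sum // => i _.
rewrite normrM ler_wpM2r // /l1norm (bigD1 i) //= lerDl.
by rewrite sumr_ge0.
Qed.

End StochasticMatrix.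

(** * Boundedness of the hunger vectors *)

Section HungerGame.
Context {R : realType} {n : nat} {P : 'M[R]_n.+1}.
Hypothesis P_trans : transition_matrix P.
Implicit Types h : 'rV[R]_n.+1.

Lemma firing_vectorS h N : firing_vector P h N.+1 =
  firing_vector P h N + delta_mx 0 (fired_state (hunger_vector P h N)).
Proof.
apply/rowP => i; rewrite !mxE -!sum1_card /= [in LHS]big_mkcond big_ord_recr /=.
rewrite natrD; congr (_ + _); first by rewrite -big_mkcond.
by rewrite unfold_in /= eq_sym; case: eqP.
Qed.

Lemma hunger_vectorE h N :
  hunger_vector P h N = h + firing_vector P h N *m (P - 1%:M).
Proof.
elim: N => [|N IHN].
  have -> : firing_vector P h 0 = 0.
    by apply/rowP => i; rewrite !mxE eq_card0 // => -[].
  by rewrite mul0mx addr0.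
rewrite firing_vectorS mulmxDl addrA -IHN -rowE.
by rewrite /hunger_vector iterS.
Qed.

Lemma sum_firing_vector h N : \sum_i firing_vector P h N 0 i = N%:R.
Proof.
elim: N => [|N IHN].
  by rewrite big1 // => i _; rewrite mxE eq_card0 // => -[].
rewrite firing_vectorS; under eq_bigr do rewrite mxE.
rewrite big_split /= IHN -natr1; congr (_ + _).
set j := fired_state _; rewrite (bigD1 j) //= mxE !eqxx big1 ?addr0 // => i.
by move=> /negPf ij; rewrite mxE ij andbF.
Qed.

Lemma sum_hunger_vector h N :
  \sum_i hunger_vector P h N 0 i = \sum_i h 0 i.
Proof.
rewrite hunger_vectorE mulmxBr mulmx1.
under eq_bigr do rewrite mxE [X in _ + X]mxE [X in _ + (_ + X)]mxE.
by rewrite big_split /= sumrB sum_mul_transition // subrr addr0.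
Qed.

Lemma sum_transition_le1 i (S : {set 'I_n.+1}) : \sum_(j in S) P i j <= 1.
Proof.
rewrite -(transition_sum P_trans i) [leRHS](bigID (mem S)) /= lerDl.
by rewrite sumr_ge0 // => j _; apply: transition_ge0.
Qed.

(** The bound is proved for all [S] at once, since the step for [S] may use the bound for
    [i |: S]. *)
Lemma set_hunger_le h N (S : {set 'I_n.+1}) :
  \sum_(i in S) hunger_vector P h N 0 i <= l1norm h + (n.+1 - #|S|)%:R.
Proof.
have A_ge0 : 0 <= l1norm h by apply: sumr_ge0.
elim: N S => [|N IHN] S.
  rewrite -[leLHS]addr0 lerD // /l1norm [leRHS](bigID (mem S)) /=.
  rewrite -[leLHS]addr0 lerD ?sumr_ge0 // ler_sum // => i _.
  exact: ler_norm.
set g := hunger_vector P h N in IHN *.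
rewrite /hunger_vector iterS -/(hunger_vector P h N) -/g /hunger_step.
have [g_le _] := fired_stateP g; set i := fired_state g in g_le *.
(* Firing [i] adds the probability of moving from [i] into [S], and subtracts one exactly when [i]
   is in [S]. *)
have -> : \sum_(j in S) (g + row i (P - 1%:M)) 0 j =
    \sum_(j in S) g 0 j + \sum_(j in S) P i j - (i \in S)%:R.
  under eq_bigr do rewrite !mxE.
  rewrite big_split sumrB /= addrA; congr (_ - _).
  have [iS|iNS] := boolP (i \in S).
    rewrite (bigD1 i) //= eqxx big1 ?addr0 // => j /andP[_].
    by rewrite eq_sym => /negPf ->.
  by rewrite big1 // => j jS; case: eqP => // ij; rewrite ij jS in iNS.
have P_le1 := sum_transition_le1 i S.
have [iS|iNS] := boolP (i \in S).
  by rewrite -addrA -[leRHS]addr0 lerD // subr_le0.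
(* As [S] misses [i], the natural subtraction [n.+1 - #|S|] is positive; one unit of it pays for the
   gain of at most one. *)
have S_lt : (#|S| < n.+1)%N.
  by have := max_card (mem (i |: S)); rewrite cardsU1 iNS card_ord.
rewrite subr0 -(subnSK S_lt) -natr1 addrA lerD //.
have [gi_ge0|gi_lt0] := leP 0 (g 0 i).
  have := IHN (i |: S); rewrite big_setU1 //= cardsU1 iNS add1n.
  by apply: le_trans; rewrite lerDr.
apply: (@le_trans _ _ 0); last by rewrite addr_ge0.
by rewrite sumr_le0 // => j _; rewrite (le_trans (g_le j)) // ltW.
Qed.

(** The upper bound is that of the singleton of [i]. The lower bound follows from the upper bound
    for its complement, since the total is conserved and at least [- l1norm h]. *)
Lemma hunger_vector_bounded h N i :
  `|hunger_vector P h N 0 i| <= 2 * l1norm h + n.+1%:R.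
Proof.
have A_ge0 : 0 <= l1norm h by apply: sumr_ge0.
have bound (S : {set 'I_n.+1}) :
    \sum_(j in S) hunger_vector P h N 0 j <= l1norm h + n.+1%:R.
  by rewrite (le_trans (set_hunger_le h N S)) // lerD2l ler_nat leq_subr.
have hi_le := bound [set i]%SET; rewrite big_set1 in hi_le.
have total := sum_hunger_vector h N; rewrite (bigD1 i) //= in total.
have hC_le := bound [set~ i]%SET.
rewrite (eq_bigl (predC1 i)) /= in hC_le; last by move=> j; rewrite !inE.
have sum_ge : - l1norm h <= \sum_j h 0 j.
  rewrite lerNl -sumrN ler_sum // => j _.
  by rewrite -normrN ler_norm.
rewrite ler_norml; apply/andP; split; lra.
Qed.

End HungerGame.

Theorem theorem5p1 (R : realType) (n : nat) (P : 'M[R]_n.+1)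
    (P_trans : transition_matrix P) (P_irr : irreducible_chain P) :
  (exists! pi : 'rV[R]_n.+1, stationary_distribution P pi) /\
  (forall (pi : 'rV[R]_n.+1) (h0 : 'rV[R]_n.+1),
     stationary_distribution P pi ->
     ((fun N : nat => N%:R^-1 *: firing_vector P h0 N) @ \oo --> pi) /\
     (exists C : R, forall N : nat, (1 <= N)%N ->
        l1norm (N%:R^-1 *: firing_vector P h0 N - pi) <= C / N%:R)).
Proof.
split.
  have [pi pi_st] := stationary_distribution_ex P_trans.
  exists pi; split=> // y.
  exact: stationary_distribution_unique.
move=> pi h0 [[_ pi1] piP].
have rate : exists C : R, forall N : nat, (1 <= N)%N ->
    l1norm (N%:R^-1 *: firing_vector P h0 N - pi) <= C / N%:R.
  have [K K_ge0 K_bound] := sum0_mul_inj_bound P_trans P_irr.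
  (* [B] bounds every entry of [h^(N) - h^(0)]: the third [l1norm h0] accounts for subtracting
     [h^(0)]. *)
  pose B : R := 3 * l1norm h0 + n.+1%:R.
  exists ((\sum_(i < n.+1) B) * K) => N N_gt0.
  have N_neq0 : N%:R != 0 :> R by rewrite pnatr_eq0 -lt0n.
  set z := _ - pi.
  have z_sum0 : \sum_i z 0 i = 0.
    under eq_bigr do rewrite !mxE -/(firing_vector P h0 N).
    rewrite sumrB pi1 -mulr_sumr.
    have := sum_firing_vector (P := P) h0 N.
    under eq_bigr do rewrite mxE.
    by move=> ->; rewrite mulVf ?subrr.
  (* [P - 1] kills [pi], so only the firing vector contributes. *)
  have zP : z *m (P - 1%:M) = N%:R^-1 *: (hunger_vector P h0 N - h0).
    rewrite hunger_vectorE [h0 + _]addrC addrK mulmxBl -scalemxAl.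
    by rewrite [pi *m _]mulmxBr piP mulmx1 subrr subr0.
  rewrite (le_trans (K_bound _ z_sum0)) // zP mulrAC ler_wpM2r //.
  rewrite /l1norm mulr_suml ler_sum // => i _; rewrite !mxE normrM mulrC.
  rewrite normfV normr_nat ler_wpM2r ?invr_ge0 //.
  have h_bound := hunger_vector_bounded P_trans h0 N i.
  have h0_le : `|h0 0 i| <= l1norm h0.
    by rewrite /l1norm (bigD1 i) //= lerDl sumr_ge0.
  by rewrite (le_trans (ler_normB _ _)) // /B; lra.
split=> //; case: rate => C rate.
(* The topology comes from the maximum norm, which is at most [l1norm], so any [N >= 1] with
   [N >= C / e] suffices. *)
apply/cvgrPdist_le => e e_gt0.
near=> N.
have N_gt0 : (0 < N)%N by near: N; exists 1%N.
rewrite distrC (le_trans (mx_norm_le_l1norm _ _ _)) //.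
rewrite (le_trans (rate N N_gt0)) //.
rewrite ler_pdivrMr ?ltr0n // -ler_pdivrMl // mulrC.
by near: N; apply: nbhs_infty_ger.
Unshelve. all: by end_near.
Qed.
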